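(* Let $\{\mathbf{x}(t)\}_{t\ge 0}$ be generated by the multiagent distributed ADMM algorithm described in the context with penalty parameter $c>0$, starting from $\mathbf{x}(0)=0$, and for $T\ge1$ let $\hat{\mathbf{x}}(T)=\frac1T\sum_{t=1}^T\mathbf{x}(t)$. Let $U$ be a bound on the subgradients of $F$ at $\mathbf{x}^*$, i.e. $\|\mathbf{v}\|_2\le U$ for all $\mathbf{v}\in\partial F(\mathbf{x}^* )$. Let $\tilde\lambda_m$ be the smallest non-zero eigenvalue of $A'D^{-1}A$ and $\lambda_M$ the largest eigenvalue of $M-A'D^{-1}A$. Then for any integer $T\ge 1$, $$|F(\hat{\mathbf{x}}(T))-F(\mathbf{x}^* )|\le\frac{c}{2T}\|\mathbf{x}^*\|_2^2\lambda_M+\frac{2}{cT}\frac{U^2}{\tilde\lambda_m},$$ and $$\|Q\hat{\mathbf{x}}(T)\|_2\le\frac{1}{2T}\|\mathbf{x}^*\|_2^2\lambda_M+\frac{1}{2T}\left(2+\frac{2U^2}{c^2\tilde\lambda_m}\right).$$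
   Context: Setting. Let $n\ge 2$ and let $(V,E)$ be a connected undirected simple graph with $V=\{1,\dots,n\}$. $N(i)$ is the set of neighbors of $i$ together with $i$ itself, and $d_i=|N(i)|-1$ is the degree of $i$. For each $i$, $f_i:\mathbb{R}\to\mathbb{R}$ is convex (the paper takes dimension one for notational simplicity), and $F(\mathbf{x})=\sum_{i=1}^n f_i(x_i)$ for $\mathbf{x}=(x_1,\dots,x_n)\in\mathbb{R}^n$; $\partial F(\mathbf{x})=\{(h_1,\dots,h_n): h_i\in\partial f_i(x_i)\}$ is its subdifferential. The matrix $A=P\in\mathbb{R}^{n\times n}$ is a communication matrix, i.e. $A_{ij}=0$ whenever $j\notin N(i)$, and it satisfies $\mathrm{null}(A)=\mathrm{span}\{\mathbf{1}\}$, where $\mathbf{1}$ is the all-ones vector. The problem $\min\{F(\mathbf{x}): A\mathbf{x}=0\}$ is assumed to have an optimal solution; $\mathbf{x}^*$ denotes one. Prime denotes transpose. $D$ is the diagonal matrix with $D_{ii}=d_i+1$, and $M$ is the diagonal matrix with $M_{ii}=\sum_{j\in N(i)}A_{ji}^2$. $Q=(A'D^{-1}A)^{1/2}$ is the symmetric positive semidefinite square root. Algorithm (penalty parameter $c>0$). Start from $\mathbf{x}(0)\in\mathbb{R}^n$, $y_i(0)=\frac{1}{d_i+1}\sum_{j\in N(i)}A_{ij}x_j(0)$, $p_i(0)=c\,y_i(0)$. For $t=0,1,2,\dots$ and all $i$: (1) $x_i(t+1)\in\arg\min_{x_i\in\mathbb{R}} f_i(x_i)+\sum_{j\in N(i)}\left(p_j(t)A_{ji}x_i+\frac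 c2\left|y_j(t)+A_{ji}(x_i-x_i(t))\right|^2\right)$; (2) $y_i(t+1)=\frac{1}{d_i+1}\sum_{j\in N(i)}A_{ij}x_j(t+1)$; (3) $p_i(t+1)=p_i(t)+c\,y_i(t+1)$. *)

(* Defs.v *)
From HB Require Import structures.
From mathcomp Require Import all_boot all_order all_algebra.
From mathcomp Require Import all_classical all_reals.
From mathcomp Require Import convex.

Set Implicit Arguments.
Unset Strict Implicit.
Unset Printing Implicit Defensive.

Import Order.TTheory GRing.Theory Num.Theory.

Local Open Scope classical_set_scope.
Local Open Scope ring_scope.

(* A vertex counts as its own neighbor: with [e] irreflexive, [#|neighbors e i|]
   is the degree of [i] plus one. *)
Definition neighbors (n : nat) (e : rel 'I_n) (i : 'I_n) : {set 'I_n} :=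
  [set j | (j == i) || e i j]%SET.

Definition degree (n : nat) (e : rel 'I_n) (i : 'I_n) : nat :=
  (#|neighbors e i| - 1)%N.

Definition simple_graph (n : nat) (e : rel 'I_n) : Prop :=
  symmetric e /\ irreflexive e.

Definition connected_graph (n : nat) (e : rel 'I_n) : Prop :=
  forall i j, connect e i j.

Section Defs.
Context {R : realType} {n : nat}.
Implicit Types (e : rel 'I_n) (f : 'I_n -> R -> R) (A B Q : 'M[R]_n).

(* The norm that MathComp-Analysis puts on matrices is the sup norm, hence this
   explicit Euclidean norm. *)
Definition norm2 (x : 'cV[R]_n) : R := Num.sqrt (\sum_i x i 0 ^+ 2).

Definition nullspace A : set 'cV[R]_n := [set x | A *m x = 0].

Definition span_ones : set 'cV[R]_n := range (fun a : R => a *: const_mx 1).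

Definition communication_matrix e A : Prop :=
  forall i j, j \notin neighbors e i -> A i j = 0.

Definition Dmx e : 'M[R]_n := diag_mx (\row_i (degree e i + 1)%:R).

Definition Mmx e A : 'M[R]_n :=
  diag_mx (\row_i \sum_(j in neighbors e i) A j i ^+ 2).

Definition Wmx e A : 'M[R]_n := A^T *m invmx (Dmx e) *m A.

Definition is_psd_sqrt Q B : Prop :=
  [/\ Q^T = Q,
      (forall v : 'cV[R]_n, 0 <= (v^T *m Q *m v) 0 0) &
      Q *m Q = B].

Definition smallest_nonzero_eigenvalue B (l : R) : Prop :=
  let S := [set a | eigenvalue B a /\ a != 0] in S l /\ lbound S l.

Definition largest_eigenvalue B (l : R) : Prop :=
  let S := [set a | eigenvalue B a] in S l /\ ubound S l.

Definition objective f (x : 'cV[R]_n) : R := \sum_i f i (x i 0).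

Definition optimal_solution f A (x : 'cV[R]_n) : Prop :=
  nullspace A x /\ forall z, nullspace A z -> objective f x <= objective f z.

Definition subdiff1 (g : R -> R) (u : R) : set R :=
  [set h | forall w, g u + h * (w - u) <= g w].

Definition subdiff f (x : 'cV[R]_n) : set 'cV[R]_n :=
  [set h | forall i, subdiff1 (f i) (x i 0) (h i 0)].

Definition argmin (g : R -> R) : set R := [set u | forall w, g u <= g w].

Definition local_average e A (x : 'cV[R]_n) (i : 'I_n) : R :=
  ((degree e i + 1)%:R)^-1 * \sum_(j in neighbors e i) A i j * x j 0.

Definition local_lagrangian e f A (c : R) (x y p : 'cV[R]_n) (i : 'I_n)
    (u : R) : R :=
  f i u + \sum_(j in neighbors e i)
    (p j 0 * A j i * u + c / 2 * `|y j 0 + A j i * (u - x i 0)| ^+ 2).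

(* [x] is a trajectory of the algorithm, with auxiliary sequences [y] and [p];
   the starting point [x 0%N] is left free, and the [argmin] step is a
   membership because minimizers need not be unique. *)
Definition admm_run e f A (c : R) (x y p : nat -> 'cV[R]_n) : Prop :=
  [/\ (forall i, y 0%N i 0 = local_average e A (x 0%N) i),
      (forall i, p 0%N i 0 = c * y 0%N i 0) &
      forall t i,
        [/\ argmin (local_lagrangian e f A c (x t) (y t) (p t) i) (x t.+1 i 0),
            y t.+1 i 0 = local_average e A (x t.+1) i &
            p t.+1 i 0 = p t i 0 + c * y t.+1 i 0]].

Definition ergodic_average (x : nat -> 'cV[R]_n) (T : nat) : 'cV[R]_n :=
  T%:R^-1 *: \sum_(1 <= t < T.+1) x t.

End Defs.

(* Main.v *)
Require Import Defs.
From HB Require Import structures.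
From mathcomp Require Import all_boot all_order all_algebra.
From mathcomp Require Import all_classical all_reals.
From mathcomp Require Import interval_inference convex.
From mathcomp Require Import spectral complex.
From mathcomp Require Import ring lra.

(** Let [xs] be the optimal solution, [W = A^T D^-1 A = Q Q], [N = M - W], and
    let [r(t)] be the sum of [Q x(s)] over [s <= t].  Since [p] accumulates
    [c y] and [y = D^-1 A x], the dual variable enters the local minimizations
    only through [A^T p(t) = c Q r(t)], so that the optimality conditions of the
    local problems, collected over all agents, become ([admm_optimality])

      [- c Q r(t+1) - c N (x(t+1) - x(t))] is a subgradient of [F] at [x(t+1)].

    The matrix [N] is positive semidefinite: this is Cauchy-Schwarz applied in
    each neighborhood ([Wmx_le_Mmx]).  Pairing the subgradient inequality with
    [xs - x(t+1)] and completing squares shows that, for every fixed vector [v],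

      [F(x(t+1)) - F(xs) + c v.Q x(t+1) <= c/2 (V(t) - V(t+1))],
      [V(t) = |r(t) - v|^2 + (x(t) - xs).N (x(t) - xs)].

    Summing, dropping [V(T) >= 0], using [x(0) = 0] and the convexity of [F],

      [F(x^) - F(xs) + c v.Q x^ <= c/(2T) (|v|^2 + xs.N xs)]  for all [v],

    where [x^] is the ergodic average ([ergodic_gap]).

    The second ingredient is a multiplier [rs] such that [- c Q rs] is a
    subgradient of [F] at [xs], hence [F(xs) <= F(x) + c rs.Q x] for all [x],
    with [|rs|^2 <= B := U^2 / (c^2 lm)] ([saddle_multiplier]).  The kernel of
    [A] being the line of constant vectors, [xs] minimizes the one-variable
    function [sum_i f_i], and the sum rule for subdifferentials provides a
    subgradient of [F] at [xs] with zero sum, that is, orthogonal to the kernel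
    of [W]; it is therefore in the range of [W], and since [W] has no
    nonzero eigenvalue below [lm], its preimage under [Q] is bounded.

    Three choices of [v] conclude.  With [v = 0] one gets the upper bound on
    [F(x^) - F(xs)]; with [v = 2 rs] and the saddle inequality, the lower bound;
    with [v = rs + q / |q|], where [q = Q x^], the bound on [|q|].  In each case
    [xs.N xs <= lM |xs|^2] since [lM] is the top of the spectrum of [N]. *)

Import Order.TTheory GRing.Theory Num.Theory.
Local Open Scope classical_set_scope.
Local Open Scope ring_scope.

(** * Quadratic forms of symmetric real matrices *)

Section Dot.
Context {R : realType} {n : nat}.
Implicit Types (u v w x : 'cV[R]_n) (B : 'M[R]_n).

Definition dot u v : R := (u^T *m v) 0 0.

Lemma dotE u v : dot u v = \sum_i u i 0 * v i 0.
Proof. by rewrite /dot mxE; apply: eq_bigr => i _; rewrite mxE. Qed.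

Lemma dotC u v : dot u v = dot v u.
Proof. by rewrite !dotE; apply: eq_bigr => i _; rewrite mulrC. Qed.

Lemma dotDr u v w : dot u (v + w) = dot u v + dot u w.
Proof. by rewrite /dot mulmxDr mxE. Qed.

Lemma dotNr u v : dot u (- v) = - dot u v.
Proof. by rewrite /dot mulmxN mxE. Qed.

Lemma dotZr a u v : dot u (a *: v) = a * dot u v.
Proof. by rewrite /dot -scalemxAr mxE. Qed.

Lemma dotDl u v w : dot (u + v) w = dot u w + dot v w.
Proof. by rewrite !(dotC _ w) dotDr. Qed.

Lemma dotNl u v : dot (- u) v = - dot u v.
Proof. by rewrite !(dotC _ v) dotNr. Qed.

Lemma dotZl a u v : dot (a *: u) v = a * dot u v.
Proof. by rewrite !(dotC _ v) dotZr. Qed.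

Definition dot_linear := (dotDl, dotDr, dotNl, dotNr, dotZl, dotZr).

Lemma dot_mulmx B u v : dot u (B *m v) = dot (B^T *m u) v.
Proof. by rewrite /dot trmx_mul trmxK mulmxA. Qed.

Lemma dot_ge0 u : 0 <= dot u u.
Proof. by rewrite dotE; apply: sumr_ge0 => i _; rewrite -expr2 sqr_ge0. Qed.

Lemma dot_eq0 u : dot u u = 0 -> u = 0.
Proof.
rewrite dotE => /eqP; rewrite psumr_eq0 => [/allP u0|i _]; last first.
  by rewrite -expr2 sqr_ge0.
apply/colP => i; rewrite mxE; have := u0 i (mem_index_enum i).
by rewrite /= mulf_eq0 orbb => /eqP.
Qed.

Lemma norm2_sqr u : norm2 u ^+ 2 = dot u u.
Proof.
rewrite /norm2 sqr_sqrtr; last by apply: sumr_ge0 => i _; rewrite sqr_ge0.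
by rewrite dotE; apply: eq_bigr => i _; rewrite expr2.
Qed.

Lemma dot_sumr (I : Type) (s : seq I) u (F : I -> 'cV[R]_n) :
  dot u (\sum_(i <- s) F i) = \sum_(i <- s) dot u (F i).
Proof. by rewrite /dot mulmx_sumr summxE. Qed.

End Dot.

Section Spectral.
Local Open Scope sesquilinear_scope.

(** Unitary diagonalization seen from one vector: the weights [w] are the squared
    moduli of the coordinates of [z] in an orthonormal basis of eigenvectors.
    Only the moments of order 0, 1 and 2 are recorded: any inequality between
    [|z|^2], [z.Cz] and [|Cz|^2] reduces to a pointwise one on the spectrum. *)
Lemma hermitian_spectral_measure {K : numClosedFieldType} {n}
    (C : 'M[K]_n) (z : 'cV[K]_n) : C \is hermsymmx ->
  exists d w : 'I_n -> K,
   [/\ forall i, eigenvalue C (d i) /\ d i \is Num.real, forall i, 0 <= w i,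
       (z ^t* *m z) 0 0 = \sum_i w i,
       (z ^t* *m C *m z) 0 0 = \sum_i w i * d i &
       (z ^t* *m (C *m C) *m z) 0 0 = \sum_i w i * d i ^+ 2].
Proof.
move=> hermC; have /orthomx_spectralP := hermitian_normalmx hermC.
have Dreal i : spectral_diag C 0 i \is Num.real.
  by have /mxOverP := hermitian_spectral_diag_real hermC; apply.
have uP := spectral_unitarymx C; rewrite invmx_unitary //.
have PtP : (spectralmx C)^t* *m spectralmx C = 1%:M.
  by rewrite -invmx_unitary // mulVmx // spectral_unit.
move: Dreal uP PtP; move: (spectral_diag C) (spectralmx C) => D P.
move=> Dreal /unitarymxP PP PtP eC; pose y := P *m z.
have quad (E : 'rV_n) : (z ^t* *m (P ^t* *m diag_mx E *m P) *m z) 0 0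
    = \sum_i y i 0 * (y i 0)^* * E 0 i.
  have -> : z ^t* *m (P ^t* *m diag_mx E *m P) *m z = y ^t* *m diag_mx E *m y.
    by rewrite /y trmx_mul map_mxM !mulmxA.
  rewrite mxE; apply: eq_bigr => i _.
  by rewrite mul_mx_diag !mxE mulrC mulrA.
clearbody y; exists (D 0), (fun i => y i 0 * (y i 0)^*); split.
- move=> i; split=> //; apply/eigenvalueP; exists (row i P).
    rewrite eC -row_mul !mulmxA PP mul1mx row_mul row_diag_mx.
    by rewrite -scalemxAl -rowE.
  apply/negP => /eqP ri0.
  have /matrixP/(_ i i) := PP; rewrite !mxE eqxx big1 => [/esym/eqP|j _].
    by rewrite oner_eq0.
  by have /rowP/(_ j) := ri0; rewrite !mxE => ->; rewrite mul0r.
- by move=> i; apply: mul_conjC_ge0.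
- have := quad (const_mx 1); rewrite diag_const_mx mulmx1 PtP mulmx1 => ->.
  by apply: eq_bigr => i _; rewrite mxE mulr1.
- by rewrite {1}eC quad.
- have -> : C *m C = P ^t* *m diag_mx (\row_i D 0 i ^+ 2) *m P.
    rewrite eC -!mulmxA (mulmxA P) PP mul1mx; congr (_ *m _).
    rewrite !mulmxA; congr (_ *m _); apply/matrixP => i j; rewrite mul_diag_mx !mxE.
    by case: eqP => [->|_]; rewrite ?mulr0n ?mulr0 // !mulr1n expr2.
  by rewrite quad; apply: eq_bigr => i _; rewrite mxE.
Qed.

Context {R : realType} {n : nat}.
Local Notation toC := (map_mx (real_complex R)).

Lemma trmxC_toC m k (B : 'M[R]_(m, k)) : (toC B) ^t* = toC B^T.
Proof.
apply/matrixP => i j; rewrite !mxE; apply/eqP.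
by rewrite eq_complex /= oppr0 !eqxx.
Qed.

(** Real symmetric matrices inherit the measure from their complexification,
    whose eigenvalues are real and hence eigenvalues of the real matrix. *)
Lemma spectral_measure (B : 'M[R]_n) (x : 'cV[R]_n) : B^T = B ->
  exists d w : 'I_n -> R,
   [/\ forall i, eigenvalue B (d i), forall i, 0 <= w i,
       dot x x = \sum_i w i,
       dot x (B *m x) = \sum_i w i * d i &
       dot (B *m x) (B *m x) = \sum_i w i * d i ^+ 2].
Proof.
move=> symB.
have hermB : toC B \is hermsymmx.
  by apply/is_hermitianmxP; rewrite expr0 scale1r [RHS]trmxC_toC symB.
have [d [w [dP w0 q0 q1 q2]]] := hermitian_spectral_measure (toC B) (toC x) hermB.
have dE i : d i = (complex.Re (d i))%:C%C by rewrite RRe_real //; case: (dP i).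
have wE i : w i = (complex.Re (w i))%:C%C by rewrite RRe_real // ger0_real.
exists (fun i => complex.Re (d i)), (fun i => complex.Re (w i)); split.
- move=> i; rewrite -(eigenvalue_map (real_complex R)) /= -dE.
  by case: (dP i).
- by move=> i; have := w0 i; rewrite wE ler0c.
- apply: (@complexI R); rewrite rmorph_sum /= -(eq_bigr _ (fun i _ => wE i)) -q0.
  by rewrite trmxC_toC -map_mxM mxE.
- apply: (@complexI R); rewrite rmorph_sum /=.
  under eq_bigr do rewrite rmorphM /= -wE -dE.
  by rewrite -q1 trmxC_toC -!map_mxM mxE /dot mulmxA.
- apply: (@complexI R); rewrite rmorph_sum /=.
  under eq_bigr do rewrite rmorphM rmorphXn /= -wE -dE.
  by rewrite -q2 trmxC_toC -!map_mxM mxE dot_mulmx symB dotC /dot !mulmxA.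
Qed.
End Spectral.

(** The functional calculus in degree two: a quadratic polynomial that is
    nonnegative on the spectrum gives a positive semidefinite matrix. *)
Lemma spectral_ge0 {R : realType} {n} (B : 'M[R]_n) (x : 'cV[R]_n) (a b g : R) :
  B^T = B -> (forall l, eigenvalue B l -> 0 <= a + b * l + g * l ^+ 2) ->
  0 <= a * dot x x + b * dot x (B *m x) + g * dot (B *m x) (B *m x).
Proof.
move=> symB pos; have [d [w [dP w0 -> -> ->]]] := @spectral_measure _ _ B x symB.
rewrite !mulr_sumr -!big_split /=; apply: sumr_ge0 => i _.
rewrite (_ : _ + _ = w i * (a + b * d i + g * d i ^+ 2)); last by ring.
by rewrite mulr_ge0 ?pos.
Qed.

Lemma eigenvalue_psd_ge0 {R : realType} {n} (B : 'M[R]_n) l :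
  (forall x : 'cV[R]_n, 0 <= dot x (B *m x)) -> eigenvalue B l -> 0 <= l.
Proof.
move=> psd /eigenvalueP[v vB v0].
have := psd v^T; rewrite /dot trmxK mulmxA vB -scalemxAl mxE.
rewrite pmulr_lge0 //; have := dot_ge0 v^T.
rewrite le_eqVlt /dot trmxK => /orP[/eqP vv|//].
case/negP: v0; apply/eqP; rewrite -[v]trmxK (@dot_eq0 _ _ v^T) ?trmx0 //.
by rewrite /dot trmxK.
Qed.

Lemma largest_eigenvalue_quad {R : realType} {n} (B : 'M[R]_n) (l : R)
    (x : 'cV[R]_n) : B^T = B ->
  largest_eigenvalue B l -> dot x (B *m x) <= dot x x * l.
Proof.
move=> symB [_ ub].
have := spectral_ge0 B x l (-1) 0 symB.
rewrite mulN1r mul0r addr0 mulrC subr_ge0; apply => a /ub; lra.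
Qed.

(** Range and kernel of a symmetric matrix are orthogonal complements: the columns
    of the cokernel matrix span the kernel. *)
Lemma sym_solve {R : realType} {n} (B : 'M[R]_n) (v : 'cV[R]_n) : B^T = B ->
  (forall z : 'cV[R]_n, B *m z = 0 -> dot v z = 0) -> exists w, B *m w = v.
Proof.
move=> symB vker; have : (v^T <= B)%MS.
  rewrite submxE; apply/eqP/rowP => j.
  have := vker (cokermx B *m delta_mx j 0); rewrite mulmxA mulmx_coker mul0mx.
  by move=> /(_ erefl); rewrite /dot mulmxA -colE mxE => ->; rewrite mxE.
move=> /submxP[u vE]; exists u^T.
by rewrite -[v]trmxK vE trmx_mul symB.
Qed.

(** * Convex functions of one real variable and their subdifferentials *)

Section Convex.
Context {R : realType}.
Implicit Types (f g : R -> R) (u w s v t : R).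

Local Notation convex f := (@convex_function R R^o [set: R] f).

(** Convexity with plain real weights instead of the bundled elements of
    [[0, 1]]. *)
Lemma convexP f : convex f <->
  forall t u w, 0 <= t <= 1 -> f (t * u + (1 - t) * w) <= t * f u + (1 - t) * f w.
Proof.
split=> [cf t u w t01|cf t u w _ _]; last first.
  by apply: cf; rewrite ge0 le1.
have t01' : Itv.spec (@Itv.num_sem R) (Itv.Real `[0%Z, 1%Z]) t.
  by rewrite /= /Itv.num_sem /= num_real in_itv.
exact: (cf (Itv.mk t01') u w (in_setT _) (in_setT _)).
Qed.

Lemma convex_sum (I : Type) (r : seq I) (F : I -> R -> R) :
  (forall i, convex (F i)) -> convex (fun u => \sum_(i <- r) F i u).
Proof.
move=> cF; apply/convexP => t u w t01.
rewrite !big_distrr -big_split /=; apply: ler_sum => i _.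
by have /convexP := cF i; apply.
Qed.

(** Jensen's inequality for the uniform mean, by peeling off the last point: the
    mean of [k+2] points is a convex combination, with weight [(k+1)/(k+2)], of
    the mean of the first [k+1] points and the last one. *)
Lemma convex_mean f (x : nat -> R) k : convex f ->
  f (k.+1%:R^-1 * \sum_(i < k.+1) x i) <= k.+1%:R^-1 * \sum_(i < k.+1) f (x i).
Proof.
move=> /convexP cf; elim: k => [|k IH].
  by rewrite !big_ord1 invr1 !mul1r.
set t : R := k.+1%:R / k.+2%:R.
have k1 : k.+1%:R != 0 :> R by rewrite pnatr_eq0.
have k2 : k.+2%:R != 0 :> R by rewrite pnatr_eq0.
have t01 : 0 <= t <= 1.
  by rewrite divr_ge0 //= ler_pdivrMr ?mul1r ?ler_nat // ltr0n.
have tE : 1 - t = k.+2%:R^-1.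
  by rewrite /t -[X in X - _](divff k2) -mulrBl -natrB ?subSnn ?mul1r.
have tk : t * k.+1%:R^-1 = k.+2%:R^-1 by rewrite /t; field; apply/andP.
have eS (G : nat -> R) : \sum_(i < k.+2) G i = \sum_(i < k.+1) G i + G k.+1.
  by rewrite big_ord_recr.
have split_mean (S a : R) :
    k.+2%:R^-1 * (S + a) = t * (k.+1%:R^-1 * S) + (1 - t) * a.
  by rewrite mulrA tk tE mulrDr.
rewrite (eS x) (eS (fun i => f (x i))) !split_mean.
apply: le_trans (cf _ _ _ t01) _; rewrite lerD2r.
by apply: ler_wpM2l => //; case/andP: t01.
Qed.

(** Fermat's rule for a convex function plus a quadratic. Comparing [u] with the
    points [u + t (w - u)] and dividing by [t] leaves the subgradient inequality
    up to an error of order [t]. *)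
Lemma subdiff1_of_argmin f u a b : convex f ->
  (forall w, f u <= f w + b * (w - u) + a * (w - u) ^+ 2) ->
  subdiff1 f u (- b).
Proof.
move=> /convexP cf fmin w; rewrite -subr_ge0.
set g := f w - _.
rewrite leNgt; apply/negP => g0.
(* If the inequality failed by [- g > 0], this [t] would make the error of order
   [t] too small to compensate; the 1 added to the denominator covers
   [a = 0] and [w = u]. *)
pose t := Num.min 1 (- g / (1 + 2 * `|a| * (w - u) ^+ 2)).
have d0 : 0 < 1 + 2 * `|a| * (w - u) ^+ 2.
  by rewrite ltr_pwDl // mulr_ge0 ?sqr_ge0 // mulr_ge0.
have t0 : 0 < t by rewrite lt_min ltr01 divr_gt0 // oppr_gt0.
have t1 : t <= 1 by rewrite ge_min lexx.
have tg : t * (1 + 2 * `|a| * (w - u) ^+ 2) <= - g.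
  by rewrite -ler_pdivlMr // ge_min lexx orbT.
have := cf t w u; rewrite t1 ltW // => /(_ isT) h1.
have := fmin (t * w + (1 - t) * u).
have -> : t * w + (1 - t) * u - u = t * (w - u) by ring.
move=> h2.
have h3 : 0 <= t * (g + t * (a * (w - u) ^+ 2)).
  rewrite (_ : _ * _ = t * f w + (1 - t) * f u + b * (t * (w - u))
    + a * (t * (w - u)) ^+ 2 - f u).
    by lra.
  by rewrite /g; ring.
rewrite pmulr_rge0 // in h3.
have h4 : t * (a * (w - u) ^+ 2) <= t * (`|a| * (w - u) ^+ 2).
  by rewrite ler_pM2l // ler_wpM2r ?sqr_ge0 // ler_norm.
nra.
Qed.

Definition slope f u w := (f w - f u) / (w - u).

Lemma le_slope f u w w' : convex f -> w != u -> w' != u -> w <= w' ->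
  slope f u w <= slope f u w'.
Proof.
move=> /convexP cf wu w'u; rewrite le_eqVlt => /predU1P[->//|ww'].
have chord a b d : a < b -> b < d -> (d - a) * f b <= (d - b) * f a + (b - a) * f d.
  move=> ab bd; have da : 0 < d - a by lra.
  have /cf h : 0 <= (d - b) / (d - a) <= 1.
    by rewrite divr_ge0 ?ler_pdivrMr ?mul1r //=; lra.
  have := h a d.
  have -> : 1 - (d - b) / (d - a) = (b - a) / (d - a) by field; rewrite gt_eqF.
  have -> : (d - b) / (d - a) * a + (b - a) / (d - a) * d = b.
    by field; rewrite gt_eqF.
  have -> : (d - b) / (d - a) * f a + (b - a) / (d - a) * f d
      = ((d - b) * f a + (b - a) * f d) / (d - a) by field; rewrite gt_eqF.
  by rewrite ler_pdivlMr // mulrC.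
rewrite /slope; case: (ltgtP w u) wu => // wu _; case: (ltgtP w' u) w'u => // w'u _.
- rewrite ler_ndivrMr ?subr_lt0 // mulrAC ler_ndivrMr ?subr_lt0 //.
  have := chord _ _ _ ww' w'u; lra.
- rewrite ler_ndivrMr ?subr_lt0 // mulrAC ler_pdivrMr ?subr_gt0 //.
  have := chord _ _ _ wu w'u; lra.
- lra.
- rewrite ler_pdivrMr ?subr_gt0 // mulrAC ler_pdivlMr ?subr_gt0 //.
  have := chord _ _ _ wu ww'; lra.
Qed.

Lemma subdiff1_slope f u v :
  (forall w, w < u -> slope f u w <= v) -> (forall w, u < w -> v <= slope f u w) ->
  subdiff1 f u v.
Proof.
move=> lo up w; case: (ltgtP w u) => [wu|uw|->].
- have := lo w wu; rewrite /slope ler_ndivrMr ?subr_lt0 // => h.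
  by rewrite -lerBrDl.
- have := up w uw; rewrite /slope ler_pdivlMr ?subr_gt0 // => h.
  by rewrite -lerBrDl.
- by rewrite subrr mulr0 addr0.
Qed.

(** The subgradients of [f] at [u] are the numbers between its slopes to the left
    and to the right of [u]. The required [v] has to lie above the left slopes of
    [f] and above [s] minus the right slopes of [g], and below the right slopes
    of [f] and [s] minus the left slopes of [g]. Any lower constraint is
    compatible with any upper one: two constraints on the same function by
    monotonicity of its slopes, two on different functions because both slopes
    can be moved to the same point, where the hypothesis on [f + g] applies.
    The supremum of the lower constraints then works. *)
Lemma subdiff1_add f g u s : convex f -> convex g ->
  subdiff1 (fun w => f w + g w) u s ->
  exists v, subdiff1 f u v /\ subdiff1 g u (s - v).
Proof.
move=> cf cg sfg.
pose L : set R := [set v | (exists2 w, w < u & v = slope f u w) \/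
                           (exists2 w, u < w & v = s - slope g u w)].
have slope_lo m : m < u -> slope f u m + slope g u m <= s.
  move=> mu; rewrite /slope -mulrDl ler_ndivrMr ?subr_lt0 //.
  by have := sfg m; lra.
have slope_up m : u < m -> s <= slope f u m + slope g u m.
  move=> mu; rewrite /slope -mulrDl ler_pdivlMr ?subr_gt0 //.
  by have := sfg m; lra.
have ubf w : u < w -> ubound L (slope f u w).
  move=> uw _ [[w' w'u ->]|[w' uw' ->]].
    by apply: le_slope; rewrite ?(lt_eqF w'u) ?(gt_eqF uw) // ltW // (lt_trans w'u).
  have um : u < Num.min w w' by rewrite lt_min uw.
  have := slope_up _ um.
  have := le_slope f u (Num.min w w') w cf.
  have := le_slope g u (Num.min w w') w' cg.
  rewrite !(gt_eqF um) !gt_eqF // !ge_min !lexx orbT.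
  move=> /(_ isT isT isT) ? /(_ isT isT isT) ?.
  lra.
have ubg w : w < u -> ubound L (s - slope g u w).
  move=> wu _ [[w' w'u ->]|[w' uw' ->]]; last first.
    rewrite lerB //.
    by apply: le_slope; rewrite ?(lt_eqF wu) ?(gt_eqF uw') // ltW // (lt_trans wu).
  have um : Num.max w w' < u by rewrite gt_max wu.
  have := slope_lo _ um.
  have := le_slope f u w' (Num.max w w') cf.
  have := le_slope g u w (Num.max w w') cg.
  rewrite !(lt_eqF um) !lt_eqF // !le_max !lexx orbT.
  move=> /(_ isT isT isT) ? /(_ isT isT isT) ?.
  lra.
have L0 : L !=set0.
  by exists (slope f u (u - 1)); left; exists (u - 1) => //; rewrite gtrBl.
have Lub : has_sup L.
  by split=> //; exists (slope f u (u + 1)); apply: ubf; rewrite ltrDl.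
exists (sup L); split; apply: subdiff1_slope => w wu.
- by apply: sup_upper_bound => //; left; exists w.
- exact: ge_sup (ubf _ wu).
- by rewrite lerBrDl -lerBrDr; exact: ge_sup (ubg _ wu).
- by rewrite lerBlDl -lerBlDr; apply: sup_upper_bound => //; right; exists w.
Qed.

(** Sum rule for finitely many summands, by splitting off one function at a time. *)
Lemma subdiff1_sum n (F : 'I_n -> R -> R) u s : (forall i, convex (F i)) ->
  subdiff1 (fun w => \sum_i F i w) u s ->
  exists2 v : 'I_n -> R, forall i, subdiff1 (F i) u (v i) & \sum_i v i = s.
Proof.
elim: n => [|n IH] in F s *.
  move=> _ sF; exists (fun=> 0); first by case.
  have := sF (u + 1); have := sF (u - 1); rewrite !big_ord0; lra.
move=> cF sF.
pose G w := \sum_(i < n) F (lift ord0 i) w.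
have [||v [v0 vS]] := @subdiff1_add (F ord0) G u s (cF _).
- by apply: convex_sum => i; apply: cF.
- by move=> w /=; have := sF w; rewrite !big_ord_recl.
have [||v' v'P v'S] := IH (fun i => F (lift ord0 i)) (s - v).
- by move=> i; apply: cF.
- exact: vS.
exists (fun i => oapp v' v (unlift ord0 i)).
  by move=> i; case: unliftP => [j ->|->].
rewrite big_ord_recl unlift_none /= (eq_bigr v') ?v'S ?subrKC //.
by move=> i _; rewrite liftK.
Qed.

End Convex.

(** * The ergodic estimate for a primal-dual sequence *)

Section PrimalDual.
Context {R : realType} {n : nat}.
Implicit Types (B Q N : 'M[R]_n) (u v w z g d : 'cV[R]_n) (f : 'I_n -> R -> R)
  (c : R) (x : nat -> 'cV[R]_n) (xs : 'cV[R]_n).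

(** The identity [2 g.Bd = g.Bg - (g-d).B(g-d) + d.Bd] with its last term dropped:
    it turns a scalar product with an increment into a telescoping difference. *)
Lemma three_point B g d : B^T = B -> 0 <= dot d (B *m d) ->
  dot g (B *m g) - dot (g - d) (B *m (g - d)) <= 2 * dot g (B *m d).
Proof.
move=> symB d0; have : dot d (B *m g) = dot g (B *m d).
  by rewrite dot_mulmx symB dotC.
rewrite mulmxBr !dot_linear => e; lra.
Qed.

Lemma objective_subdiff f u v z : subdiff f u v ->
  objective f u + dot v (z - u) <= objective f z.
Proof.
move=> sv; rewrite /objective dotE -big_split /=; apply: ler_sum => i _.
by have := sv i (z i 0); rewrite !mxE.
Qed.

Lemma objective_average f x k :
  (forall i, @convex_function R R^o [set: R] (f i)) ->
  objective f (k.+1%:R^-1 *: \sum_(i < k.+1) x i) <=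
  k.+1%:R^-1 * \sum_(i < k.+1) objective f (x i).
Proof.
move=> cf; rewrite /objective exchange_big mulr_sumr /=; apply: ler_sum => i _.
by have := convex_mean (f i) (fun t => x t i 0) k (cf i); rewrite mxE summxE.
Qed.

Lemma ergodic_averageS x k :
  ergodic_average x k.+1 = k.+1%:R^-1 *: \sum_(i < k.+1) x i.+1.
Proof. by rewrite /ergodic_average big_add1 big_mkord. Qed.

Definition partial_residual Q x t : 'cV[R]_n := \sum_(s < t.+1) Q *m x s.

(** With [v] a multiplier and [xs] a solution, this is the squared distance to the
    saddle point in the metric for which the iteration is a proximal step. *)
Definition lyapunov Q N x xs v t : R :=
  dot (partial_residual Q x t - v) (partial_residual Q x t - v)
  + dot (x t - xs) (N *m (x t - xs)).

(** The subgradient inequality at [x t.+1] tested at [xs] has two inner products,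
    one with the increment [Q x(t+1)] of the residual, one with the increment of
    [x] in the metric [N]; [three_point] applies to both. *)
Lemma lyapunov_step f Q N c x xs v t :
  0 < c -> Q^T = Q -> N^T = N -> (forall z, 0 <= dot z (N *m z)) ->
  Q *m xs = 0 ->
  subdiff f (x t.+1)
    (- (c *: (Q *m partial_residual Q x t.+1)
        + c *: (N *m (x t.+1 - x t)))) ->
  objective f (x t.+1) - objective f xs + c * dot v (Q *m x t.+1)
    <= c / 2 * (lyapunov Q N x xs v t - lyapunov Q N x xs v t.+1).
Proof.
move=> c0 symQ symN psdN Qxs /(objective_subdiff _ _ _ xs) h3.
rewrite /lyapunov; set r := partial_residual Q x in h3 *.
have rS : r t.+1 = r t + Q *m x t.+1 by rewrite /r /partial_residual big_ord_recr.
have := three_point N (x t.+1 - xs) (x t.+1 - x t) symN (psdN _).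
have -> : x t.+1 - xs - (x t.+1 - x t) = x t - xs.
  by rewrite opprB addrC addrA subrK.
have := three_point 1%:M (r t.+1 - v) (Q *m x t.+1) (trmx1 _ _).
rewrite !mul1mx => /(_ (dot_ge0 _)).
have -> : r t.+1 - v - Q *m x t.+1 = r t - v by rewrite rS addrAC addrK.
move: h3; rewrite -[xs - _]opprB dotNl dotNr opprK [dot (c *: _ + _) _]dotDl !dotZl.
rewrite -{1}symQ -dot_mulmx mulmxBr Qxs subr0 [dot (N *m _) _]dotC.
move=> h3 h1 h2.
have -> : c * dot v (Q *m x t.+1)
    = c * dot (r t.+1) (Q *m x t.+1) - c * dot (r t.+1 - v) (Q *m x t.+1).
  by rewrite !dot_linear; ring.
set E := objective f (x t.+1) in h3 *.
set F := objective f xs in h3 *.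
nra.
Qed.

(** Telescoping of [lyapunov_step], followed by Jensen's inequality. The estimate
    is uniform in [v]; choosing [v] afterwards is what separates the objective
    from the constraint violation. *)
Lemma ergodic_gap f Q N c x xs v T :
  (forall i, @convex_function R R^o [set: R] (f i)) ->
  0 < c -> Q^T = Q -> N^T = N -> (forall z, 0 <= dot z (N *m z)) ->
  Q *m xs = 0 -> x 0%N = 0 ->
  (forall t, subdiff f (x t.+1)
    (- (c *: (Q *m partial_residual Q x t.+1) + c *: (N *m (x t.+1 - x t))))) ->
  (0 < T)%N ->
  objective f (ergodic_average x T) - objective f xs
    + c * dot v (Q *m ergodic_average x T)
  <= c / (2 * T%:R) * (dot v v + dot xs (N *m xs)).
Proof.
move=> cf c0 symQ symN psdN Qxs x0 sub; case: T => // k _.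
pose V := lyapunov Q N x xs v.
have k0 : 0 < k.+1%:R :> R by rewrite ltr0n.
have Vge0 t : 0 <= V t by rewrite addr_ge0 ?dot_ge0.
have V0 : V 0%N = dot v v + dot xs (N *m xs).
  rewrite /V /lyapunov /partial_residual big_ord1 x0 mulmx0 !sub0r mulmxN.
  by rewrite !dot_linear !opprK.
have sum_step : \sum_(t < k.+1) (objective f (x t.+1) - objective f xs
    + c * dot v (Q *m x t.+1)) <= c / 2 * V 0%N.
  apply: (@le_trans _ _ (\sum_(t < k.+1) c / 2 * (V t - V t.+1))).
    by apply: ler_sum => t _; apply: lyapunov_step.
  rewrite -mulr_sumr -(big_mkord xpredT (fun t => V t - V t.+1)).
  apply: ler_wpM2l; first by rewrite divr_ge0 ?ltW.
  rewrite (eq_bigr (fun t => - (V t.+1 - V t))) => [|t _]; last by rewrite opprB.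
  by rewrite sumrN telescope_sumr // opprB gerBl.
rewrite ergodic_averageS.
have jensen := objective_average f (fun t => x t.+1) k cf.
rewrite -V0 (_ : c / _ = k.+1%:R^-1 * (c / 2)); last first.
  by field; rewrite gt_eqF.
rewrite -[_ * V 0%N]mulrA.
apply: le_trans (ler_wpM2l _ sum_step); last by rewrite invr_ge0 ltW.
rewrite big_split sumrB /= sumr_const card_ord !mulrDr mulrN.
rewrite -[objective f xs *+ _]mulr_natl.
rewrite (mulrA _ k.+1%:R) mulVf ?gt_eqF // mul1r.
by rewrite -scalemxAr dotZr mulmx_sumr dot_sumr mulrCA [c * _]mulr_sumr !lerD2r.
Qed.

End PrimalDual.

(** * The matrices of the network and the optimality conditions *)

(** The Cauchy-Schwarz inequality against the constant 1, in the form: the variance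
    of [a] on [S] is nonnegative. *)
Lemma sqr_sum_le {R : realFieldType} (I : finType) (S : {set I}) (a : I -> R) :
  (0 < #|S|)%N ->
  #|S|%:R^-1 * (\sum_(j in S) a j) ^+ 2 <= \sum_(j in S) a j ^+ 2.
Proof.
move=> S0; set s := \sum_(j in S) a j.
have k0 : #|S|%:R != 0 :> R by rewrite pnatr_eq0 -lt0n.
have : 0 <= \sum_(j in S) (a j - #|S|%:R^-1 * s) ^+ 2.
  by apply: sumr_ge0 => j _; rewrite sqr_ge0.
have -> : \sum_(j in S) (a j - #|S|%:R^-1 * s) ^+ 2
    = \sum_(j in S) a j ^+ 2 - \sum_(j in S) a j * (2 * (#|S|%:R^-1 * s))
      + \sum_(j in S) (#|S|%:R^-1 * s) ^+ 2.
  rewrite -sumrB -big_split /=; apply: eq_bigr => j _; ring.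
rewrite -mulr_suml -/s sumr_const -[_ ^+ 2 *+ _]mulr_natl.
have -> : #|S|%:R * (#|S|%:R^-1 * s) ^+ 2 = #|S|%:R^-1 * s ^+ 2 by field.
lra.
Qed.

Section Network.
Context {R : realType} {n : nat}.
Context (e : rel 'I_n) (A : 'M[R]_n).
Context (he : simple_graph e) (hA : communication_matrix e A).

Let deg i : R := (degree e i + 1)%:R.

Lemma degree_gt0 i : 0 < (degree e i + 1)%:R :> R.
Proof. by rewrite ltr0n addn1. Qed.

Lemma mulmx_nbr (B : 'M[R]_n) (x : 'cV[R]_n) i : communication_matrix e B ->
  (B *m x) i 0 = \sum_(j in neighbors e i) B i j * x j 0.
Proof.
move=> cB; rewrite mxE [LHS](bigID (mem (neighbors e i))) /=.
rewrite [X in _ + X]big1 ?addr0 //.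
by move=> j /cB ->; rewrite mul0r.
Qed.

Lemma neighbors_sym i j : (i \in neighbors e j) = (j \in neighbors e i).
Proof. by case: he => se _; rewrite !inE eq_sym se. Qed.

Lemma communication_trmx : communication_matrix e A^T.
Proof. by move=> i j; rewrite mxE neighbors_sym => /hA. Qed.

Lemma card_neighbors i : #|neighbors e i| = (degree e i + 1)%N.
Proof.
rewrite /degree subnK // card_gt0; apply/set0Pn; exists i.
by rewrite inE eqxx.
Qed.

Lemma invDmx : invmx (Dmx e) = diag_mx (\row_i (deg i)^-1).
Proof.
have DE : Dmx e *m diag_mx (\row_i (deg i)^-1) = 1%:M :> 'M[R]_n.
  apply/matrixP => i j; rewrite mul_diag_mx !mxE.
  case: eqP => [->|_]; last by rewrite !mulr0n mulr0.
  by rewrite !mulr1n mulfV // gt_eqF ?degree_gt0.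
have [uD _] := mulmx1_unit DE.
by rewrite -[RHS](mulKmx uD) DE mulmx1.
Qed.

Lemma local_averageE (x : 'cV[R]_n) i :
  local_average e A x i = (invmx (Dmx e) *m (A *m x)) i 0.
Proof. by rewrite invDmx mul_diag_mx !mxE /local_average -mulmx_nbr // mxE. Qed.

Lemma Wmx_sym : (Wmx e A)^T = Wmx e A.
Proof. by rewrite /Wmx !trmx_mul trmxK invDmx tr_diag_mx mulmxA. Qed.

Lemma Mmx_sym : (Mmx e A)^T = Mmx e A.
Proof. exact: tr_diag_mx. Qed.

Lemma dot_Wmx (x : 'cV[R]_n) :
  dot x (Wmx e A *m x) = \sum_i (deg i)^-1 * (A *m x) i 0 ^+ 2.
Proof.
rewrite /Wmx -!mulmxA dot_mulmx trmxK dotE; apply: eq_bigr => i _.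
by rewrite invDmx mul_diag_mx !mxE mulrCA.
Qed.

Lemma Wmx_psd (x : 'cV[R]_n) : 0 <= dot x (Wmx e A *m x).
Proof.
rewrite dot_Wmx; apply: sumr_ge0 => i _.
by rewrite mulr_ge0 ?sqr_ge0 // invr_ge0 ltW ?degree_gt0.
Qed.

(** [W] has no more kernel than [A] because its quadratic form is a sum of squares
    of the entries of [A x] with positive weights. *)
Lemma Wmx_ker (x : 'cV[R]_n) : Wmx e A *m x = 0 -> A *m x = 0.
Proof.
move=> Wx; have := dot_Wmx x; rewrite Wx /dot mulmx0 mxE => /esym/eqP.
rewrite psumr_eq0 => [/allP A0|i _]; last first.
  by rewrite mulr_ge0 ?sqr_ge0 // invr_ge0 ltW ?degree_gt0.
apply/colP => i; have := A0 i (mem_index_enum i).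
rewrite /= mulf_eq0 invr_eq0 gt_eqF ?degree_gt0 //= sqrf_eq0 => /eqP ->.
by rewrite mxE.
Qed.

(** Cauchy-Schwarz in the neighborhood of each [i], whose size cancels the weight
    [1/(d_i + 1)]; exchanging the two sums, which is where the symmetry of the
    graph enters, collects the coefficients of [M]. *)
Lemma Wmx_le_Mmx (x : 'cV[R]_n) : dot x (Wmx e A *m x) <= dot x (Mmx e A *m x).
Proof.
rewrite dot_Wmx dotE.
apply: (@le_trans _ _ (\sum_i \sum_(j in neighbors e i) (A i j * x j 0) ^+ 2)).
  apply: ler_sum => i _; rewrite mulmx_nbr // /deg -card_neighbors.
  by apply: sqr_sum_le; rewrite card_neighbors addn1.
under eq_bigr do rewrite big_mkcond.
rewrite exchange_big /=; apply: ler_sum => j _.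
rewrite -big_mkcond /= mul_diag_mx !mxE.
rewrite (eq_bigl (mem (neighbors e j))) => [|i]; last exact: neighbors_sym.
by rewrite mulrCA -expr2 mulr_suml; under eq_bigr do rewrite exprMn.
Qed.

(** The local objective of agent [i] is [f i] plus a quadratic whose derivative at
    the new point is, up to sign, the [i]-th entry of the vector below. *)
Lemma admm_subdiff (f : 'I_n -> R -> R) c x y p t :
  (forall i, @convex_function R R^o [set: R] (f i)) ->
  admm_run e f A c x y p ->
  subdiff f (x t.+1)
    (- (A^T *m (p t + c *: y t) + c *: (Mmx e A *m (x t.+1 - x t)))).
Proof.
move=> cf [_ _ run] i; have [xmin _ _] := run t i; rewrite mxE.
apply: (@subdiff1_of_argmin _ (f i) _ (c / 2 * \sum_(j in neighbors e i) A j i ^+ 2))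
  => // w.
have := xmin w; set u := x t.+1 i 0; rewrite /local_lagrangian.
pose F (w : R) := \sum_(j in neighbors e i)
  (p t j 0 * A j i * w + c / 2 * `|y t j 0 + A j i * (w - x t i 0)| ^+ 2).
rewrite -[f i w + _]/(f i w + F w) -[f i u + _]/(f i u + F u) => h.
suff E : (A^T *m (p t + c *: y t) + c *: (Mmx e A *m (x t.+1 - x t))) i 0 * (w - u)
  + c / 2 * (\sum_(j in neighbors e i) A j i ^+ 2) * (w - u) ^+ 2 = F w - F u.
  by rewrite -addrA E; lra.
rewrite mxE mulmx_nbr; last exact: communication_trmx.
rewrite mxE mul_diag_mx !mxE /F -/u -sumrB.
rewrite mulrDl mulr_suml mulrA mulr_sumr !mulr_suml mulr_sumr !mulr_suml.
rewrite -!big_split /=; apply: eq_bigr => j _.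
rewrite !mxE !real_normK ?num_real //.
by field.
Qed.

(** The part of the dual variable seen by the primal step is a function of the past
    residuals alone; this is what lets [Q] replace [A] in the analysis. *)
Lemma admm_dual Q (f : 'I_n -> R -> R) c x y p t :
  Q *m Q = Wmx e A -> admm_run e f A c x y p ->
  A^T *m y t = Wmx e A *m x t /\
  A^T *m p t = c *: (Q *m partial_residual Q x t).
Proof.
move=> QQ [y0 p0 run].
have yE s : y s = invmx (Dmx e) *m (A *m x s).
  apply/colP => i; rewrite -local_averageE; case: s => [|s]; first exact: y0.
  by have [] := run s i.
have AyE s : A^T *m y s = Wmx e A *m x s by rewrite yE /Wmx !mulmxA.
split=> //; elim: t => [|t IH].
  have -> : p 0%N = c *: y 0%N by apply/colP => i; rewrite p0 mxE.
  by rewrite -scalemxAr AyE /partial_residual big_ord1 mulmxA QQ.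
have -> : p t.+1 = p t + c *: y t.+1.
  by apply/colP => i; rewrite !mxE; have [] := run t i.
rewrite mulmxDr IH -scalemxAr AyE -QQ -mulmxA -scalerDr -mulmxDr.
by rewrite /partial_residual [in RHS]big_ord_recr.
Qed.

(** Replacing [p(t)] by [p(t+1) - c y(t+1)] in [admm_subdiff] makes the scheme
    implicit in the dual variable and changes the metric from [M] to [M - W]. *)
Lemma admm_optimality Q (f : 'I_n -> R -> R) c x y p t :
  (forall i, @convex_function R R^o [set: R] (f i)) ->
  Q *m Q = Wmx e A -> admm_run e f A c x y p ->
  subdiff f (x t.+1) (- (c *: (Q *m partial_residual Q x t.+1)
                         + c *: ((Mmx e A - Wmx e A) *m (x t.+1 - x t)))).
Proof.
move=> cf QQ run; have := admm_subdiff _ _ _ _ _ t cf run.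
have [Ay Ap] := admm_dual Q _ _ _ _ _ t QQ run.
rewrite mulmxDr -scalemxAr Ay Ap /partial_residual [in X in _ -> X]big_ord_recr /=.
rewrite [Q *m (_ + _)]mulmxDr (mulmxA Q Q) QQ mulmxBl -!scalerDr mulmxBr.
congr (subdiff _ _ (- (c *: _))).
by rewrite [Wmx e A *m (_ - _)]mulmxBr; apply/colP => i; rewrite !mxE; ring.
Qed.

End Network.

(** * The saddle point *)

Section Saddle.
Context {R : realType} {n : nat}.

(** On the line of constant vectors the objective is the one-variable function
    [sum_i f i], minimized at the common value [a] of the entries of [xs]; so 0 is
    a subgradient of that sum at [a], and the sum rule splits it among agents. *)
Lemma consensus_subgradient (f : 'I_n -> R -> R) (A : 'M[R]_n) (xs : 'cV[R]_n) :
  (forall i, @convex_function R R^o [set: R] (f i)) ->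
  nullspace A = span_ones -> optimal_solution f A xs ->
  exists2 v, subdiff f xs v & dot v (const_mx 1) = 0.
Proof.
move=> cf nullA [xs0 opt].
have [a _ xsE] : span_ones xs by rewrite -nullA.
have [|v vP vS] := subdiff1_sum n f a 0 cf.
  move=> w; rewrite mul0r addr0.
  have := opt (w *: const_mx 1); rewrite nullA /objective -xsE.
  move=> /(_ (ex_intro2 _ _ w I erefl)).
  by congr (_ <= _); apply: eq_bigr => i _; rewrite !mxE mulr1.
exists (\col_i v i).
  by move=> i; rewrite mxE -xsE !mxE mulr1.
by rewrite dotE -[RHS]vS; apply: eq_bigr => i _; rewrite !mxE mulr1.
Qed.

(** With [v] the zero-sum subgradient and [W w = v], take [r = - Q w / c]. Then
    [c^2 |r|^2 = w.Ww], while [|v|^2 = |Ww|^2 >= lm w.Ww] because every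
    eigenvalue [l] of [W] is 0 or at least [lm], so that [l^2 >= lm l]. *)
Lemma saddle_multiplier (e : rel 'I_n) (f : 'I_n -> R -> R) (A Q : 'M[R]_n)
    (xs : 'cV[R]_n) (c U lm : R) :
  (forall i, @convex_function R R^o [set: R] (f i)) ->
  nullspace A = span_ones -> optimal_solution f A xs -> 0 < c ->
  (forall v, subdiff f xs v -> norm2 v <= U) ->
  Q^T = Q -> Q *m Q = Wmx e A ->
  smallest_nonzero_eigenvalue (Wmx e A) lm ->
  exists r : 'cV[R]_n, subdiff f xs (- (c *: (Q *m r))) /\
    dot r r <= U ^+ 2 / (c ^+ 2 * lm).
Proof.
move=> cf nullA opt c0 hU symQ QQ [[lmW lm0] lmmin].
have lm_gt0 : 0 < lm.
  rewrite lt_neqAle eq_sym lm0 /=; apply: eigenvalue_psd_ge0 lmW => x.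
  exact: Wmx_psd.
have [v vsub v1] := consensus_subgradient f A xs cf nullA opt.
have [||w Ww] := sym_solve (Wmx e A) v.
- exact: Wmx_sym.
- move=> z /Wmx_ker Az; have [a _ <-] : span_ones z by rewrite -nullA.
  by rewrite dotZr v1 mulr0.
have spec : 0 <= - lm * dot w v + dot v v.
  have := spectral_ge0 (Wmx e A) w 0 (- lm) 1 (Wmx_sym _ _).
  rewrite Ww mul0r add0r mul1r; apply => l lW.
  have l0 : 0 <= l by apply: eigenvalue_psd_ge0 lW => x; apply: Wmx_psd.
  have [->|lN0] := eqVneq l 0; first by rewrite expr0n mulr0 !addr0 mulr0.
  have : lm <= l by apply: lmmin.
  nra.
have vU : dot v v <= U ^+ 2.
  rewrite -norm2_sqr lerXn2r ?nnegrE ?sqrtr_ge0 ?hU //.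
  by rewrite (le_trans _ (hU _ vsub)) ?sqrtr_ge0.
have Qw : dot (Q *m w) (Q *m w) = dot w v.
  by rewrite dot_mulmx symQ mulmxA QQ Ww dotC.
exists (- c^-1 *: (Q *m w)); split.
  rewrite -scalemxAr mulmxA QQ Ww scalerA mulrN mulfV ?gt_eqF // scaleN1r opprK.
  exact: vsub.
rewrite !dot_linear Qw ler_pdivlMr ?mulr_gt0 ?exprn_gt0 //.
rewrite (_ : _ * (c ^+ 2 * lm) = lm * dot w v); first lra.
by field; rewrite gt_eqF.
Qed.

End Saddle.

(** * Convergence rates *)

Theorem theorem2 (R : realType) (n : nat) (hn : (2 <= n)%N)
  (e : rel 'I_n) (he : simple_graph e) (hconn : connected_graph e)
  (f : 'I_n -> R -> R)
  (hf : forall i, @convex_function R R^o [set: R] (f i))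
  (A : 'M[R]_n) (hA : communication_matrix e A)
  (hnull : nullspace A = span_ones)
  (xstar : 'cV[R]_n) (hopt : optimal_solution f A xstar)
  (c : R) (hc : 0 < c)
  (x y p : nat -> 'cV[R]_n) (hrun : admm_run e f A c x y p)
  (hx0 : x 0%N = 0)
  (U : R) (hU : forall v, subdiff f xstar v -> norm2 v <= U)
  (Q : 'M[R]_n) (hQ : is_psd_sqrt Q (Wmx e A))
  (lm : R) (hlm : smallest_nonzero_eigenvalue (Wmx e A) lm)
  (lM : R) (hlM : largest_eigenvalue (Mmx e A - Wmx e A) lM)
  (T : nat) (hT : (1 <= T)%N) :
  `|objective f (ergodic_average x T) - objective f xstar|
    <= c / (2 * T%:R) * norm2 xstar ^+ 2 * lM
       + 2 / (c * T%:R) * (U ^+ 2 / lm)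
  /\
  norm2 (Q *m ergodic_average x T)
    <= 1 / (2 * T%:R) * norm2 xstar ^+ 2 * lM
       + 1 / (2 * T%:R) * (2 + 2 * U ^+ 2 / (c ^+ 2 * lm)).
Proof.
have [symQ _ QQ] := hQ; set N := Mmx e A - Wmx e A in hlM.
have symN : N^T = N by rewrite /N linearB /= Mmx_sym Wmx_sym.
have psdN z : 0 <= dot z (N *m z).
  by rewrite mulmxBl dot_linear dotNr subr_ge0 Wmx_le_Mmx.
have [xs0 _] := hopt; have [[_ lm0] _] := hlm.
have Qxs : Q *m xstar = 0.
  apply: dot_eq0; rewrite dot_mulmx symQ mulmxA QQ /Wmx -mulmxA xs0 mulmx0.
  by rewrite dotC /dot mulmx0 mxE.
have [rs [rsub rsU]] :=
  saddle_multiplier e f A Q xstar c U lm hf hnull hopt hc hU symQ QQ hlm.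
have NlM := largest_eigenvalue_quad N lM xstar symN hlM.
set B := U ^+ 2 / (c ^+ 2 * lm) in rsU *.
set xh := ergodic_average x T.
have T0 : 0 < T%:R :> R by rewrite ltr0n.
have gap v : objective f xh - objective f xstar + c * dot v (Q *m xh)
    <= c / (2 * T%:R) * (dot v v + dot xstar xstar * lM).
  have h := ergodic_gap f Q N c x xstar v T hf hc symQ symN psdN Qxs hx0 _ hT.
  apply: le_trans (h _) _.
    by move=> t; apply: (admm_optimality _ _ _ _ _ _ _ x y p).
  by rewrite ler_wpM2l ?lerD2l // divr_ge0 ?mulr_ge0 ?ltW.
have saddle : objective f xstar <= objective f xh + c * dot rs (Q *m xh).
  have := objective_subdiff f xstar _ xh rsub.
  rewrite dotNl dotZl -{1}symQ -dot_mulmx mulmxBr Qxs subr0.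
  by rewrite lerBlDr.
rewrite norm2_sqr.
set D := objective f xh in gap saddle *; set D' := objective f xstar in gap saddle *.
have kgt0 : 0 < c / (2 * T%:R) by rewrite divr_gt0 ?mulr_gt0.
set k := c / (2 * T%:R) in gap kgt0 *.
set X := dot xstar xstar * lM in gap *.
have B0 : 0 <= B := le_trans (dot_ge0 rs) rsU.
have -> : 2 / (c * T%:R) * (U ^+ 2 / lm) = k * (4 * B).
  by rewrite /k /B; field; rewrite lm0 !gt_eqF.
have kB : k * dot rs rs <= k * B by rewrite ler_pM2l.
split.
  rewrite -mulrA -/X ler_norml; apply/andP; split.
    have := gap (2 *: rs); rewrite !dot_linear => h; lra.
  have := gap 0; rewrite /dot trmx0 !mul0mx mxE => h; nra.
set q := Q *m xh in gap saddle *.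
have q2 := norm2_sqr q.
set s := norm2 q in q2 *.
have s0 : 0 <= s by rewrite sqrtr_ge0.
(* The convention [0^-1 = 0] makes [s^-1 *: q] the unit vector along [q], or 0 if
   [q = 0], so that this case needs no separate treatment. *)
have ss : s^-1 * s ^+ 2 = s.
  by have [->|sN0] := eqVneq s 0; [rewrite invr0 mul0r | field].
have ss1 : (s^-1) ^+ 2 * s ^+ 2 <= 1.
  have [->|sN0] := eqVneq s 0; first by rewrite invr0 !expr0n mulr0.
  by rewrite -exprMn mulVf // expr1n.
have := gap (rs + s^-1 *: q).
rewrite dotDl dotZl -q2 ss.
have norm_le : dot (rs + s^-1 *: q) (rs + s^-1 *: q) <= 2 * B + 2.
  have := dot_ge0 (rs - s^-1 *: q).
  rewrite !dot_linear (dotC q rs) -q2; lra.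
move=> h.
have : c * s <= k * (2 * B + 2 + X) by nra.
have -> : k = c * (1 / (2 * T%:R)) by rewrite /k mul1r.
rewrite -mulrA ler_pM2l // -/X => {}h.
apply: le_trans h _.
by rewrite -(mulrA 2) -/B -(mulrA _ (dot _ _)) -/X; lra.
Qed.
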